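(* Fix constants $\alpha>0$, $\beta>0$ and $\gamma_P>2$. Let $f(n):=n^{2/3}\ln^{1/3}n$, $s:=\min\{\lceil\alpha f(n)\rceil,n-1\}$ and $g:=(\beta s\ln n)^{1/2}$, and suppose $s<n-1$. Let $c_{nk}$ be the number of comparisons made by the nonrecursive SELECT on an input list of size $n$ with rank $k$, and set $$\hat\gamma_P:=(4\gamma_P+2)(\beta/\alpha)^{1/2}+(2\gamma_P-1)\big[\alpha+1/f(n)\big].$$ Then $$\mathrm{P}\big[c_{nk}\le n+\min\{k,n-k\}+\hat\gamma_P f(n)\big]\ge1-4n^{-2\beta}.$$ The same holds with $f(n)$ in the definition of $\hat\gamma_P$ replaced by $f(3)$. Moreover, if $\beta\ge1/6$, then $$\mathrm{E}\,c_{nk}\le n+\min\{k,n-k\}+(\hat\gamma_P+4\gamma_P+2)f(n).$$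
   Context: Nonrecursive SELECT. The input is a list $X=(x_1,\dots,x_n)$ of elements of a totally ordered set (repeated values allowed) and an integer $1\le k\le n$. Let $\mathcal R$ be a deterministic routine that finds the $i$th smallest of any $m$ elements using at most $\gamma_P m$ comparisons. 1. Choose a set $I$ of $s$ positions uniformly at random among all $s$-subsets of $\{1,\dots,n\}$. The sample is $S=(x_j)_{j\in I}$ with sorted elements $y_1^*\le\dots\le y_s^*$. 2. Set $i_u:=\max\{\lceil ks/n-g\rceil,1\}$ and $i_v:=\min\{\lceil ks/n+g\rceil,s\}$. Compute $u:=y_{i_u}^*$ and $v:=y_{i_v}^*$ using $\mathcal R$ at most twice on at most $s$ elements, so this step uses at most $2\gamma_P s$ comparisons. 3. Partition. Each $x_j$ with $j\notin I$ is compared with the pivots. - If $k<n/2$: $x_j$ is compared with $v$ first, and with $u$ only if $x_j<v$ and $u<v$. - If $k\ge n/2$: $x_j$ is compared with $u$ first, and with $v$ only if $x_j>u$ and $u<v$. Sample elements are not compared. Hence this step uses $c$ comparisons, where $c=n-s$ if $u=v$, $c=(n-s)+|\{j\notin I:x_j<v\}|$ if $u<v$ and $k<n/2$, and $c=(n-s)+|\{j\notin I:x_j>u\}|$ if $u<v$ and $k\ge n/2$. 4. Let $L=\{x<u\}$, $U=\{x=u\}$, $M=\{u<x<v\}$ and $R=\{x>v\}$. - If $|L|<k\le|L\cup U|$, return $u$; if $|L\cup U\cup M|<k\le n-|R|$, return $v$. In either case set $\hat n:=0$. - Otherwise let $\hat X$ be $L$ if $k\le|L|$, else $R$ if $n-|R|<k$,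 else $M$. Let $\hat n:=|\hat X|$ and find the answer in $\hat X$ with $\mathcal R$, using at most $\gamma_P\hat n$ comparisons. The total count $c_{nk}$ consists of the comparisons in steps 2, 3 and 4, so $c_{nk}\le 2\gamma_P s+c+\gamma_P\hat n$. $\mathrm{P}$ and $\mathrm{E}$ are with respect to the random sample. *)

(* Defs.v *)
From HB Require Import structures.
From mathcomp Require Import all_boot all_order all_algebra.
From mathcomp Require Import mathcomp_extra boolp classical_sets reals exp.

Set Implicit Arguments.
Unset Strict Implicit.
Unset Printing Implicit Defensive.

Import Order.TTheory GRing.Theory Num.Theory.
Local Open Scope ring_scope.

Definition fsel {R : realType} (n : nat) : R :=
  (n%:R) `^ (2 / 3) * (ln (n%:R)) `^ (1 / 3).

Definition sample_size {R : realType} (alpha : R) (n : nat) : nat :=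
  minn (absz (Num.ceil (alpha * fsel n))) n.-1.

Definition gap {R : realType} (alpha beta : R) (n : nat) : R :=
  Num.sqrt (beta * (sample_size alpha n)%:R * ln (n%:R)).

Definition idx_u {R : realType} (alpha beta : R) (n k : nat) : nat :=
  let s := sample_size alpha n in
  absz (Num.max (Num.ceil (k%:R * s%:R / n%:R - gap alpha beta n)) 1).

Definition idx_v {R : realType} (alpha beta : R) (n k : nat) : nat :=
  let s := sample_size alpha n in
  absz (Num.min (Num.ceil (k%:R * s%:R / n%:R + gap alpha beta n)) s%:Z).

(* gamma_hat, with the value F used in place of f(n) inside the bracket *)
Definition gamma_hat {R : realType} (alpha beta gammaP F : R) : R :=
  (4 * gammaP + 2) * Num.sqrt (beta / alpha) + (2 * gammaP - 1) * (alpha + 1 / F).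

Section Select.
Context {d : Order.disp_t} {T : orderType d}.

(* i-th smallest (1-indexed) element of a nonempty list *)
Definition order_stat (S : seq T) (i : nat) : option T :=
  if S is y :: _ then Some (nth y (sort <=%O S) i.-1) else None.

(* Number of comparisons c_{nk} made by the nonrecursive SELECT on input X
   with rank k, when the sample positions are I, and when the deterministic
   routine R uses rc l i comparisons to find the i-th smallest of the list l. *)
Definition select_count {R : realType} (alpha beta : R)
  (rc : seq T -> nat -> nat) (n : nat) (X : n.-tuple T) (k : nat)
  (I : {set 'I_n}) : nat :=
  let s := sample_size alpha n in
  let iu := idx_u alpha beta n k in
  let iv := idx_v alpha beta n k in
  let S := [seq tnth X j | j <- enum I] in
  let notS := [seq tnth X j | j <- enum (~: I)] in
  let xs := val X in
  match order_stat S iu, order_stat S iv with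
  | Some u, Some v =>
    let c := if (u < v)%O then
               (if (k.*2 < n)%N then ((n - s) + count (fun x => x < v)%O notS)%N
                else ((n - s) + count (fun x => u < x)%O notS)%N)
             else (n - s)%N in
    let pL := (fun x => x < u)%O in
    let pU := (fun x => x == u) in
    let pM := (fun x => (u < x) && (x < v))%O in
    let pR := (fun x => v < x)%O in
    let nL := count pL xs in
    let nLU := count (fun x => pL x || pU x) xs in
    let nLUM := count (fun x => [|| pL x, pU x | pM x]) xs in
    let nR := count pR xs in
    let step4 :=
      if ((nL < k <= nLU) || (nLUM < k <= n - nR))%N then 0%N
      else if (k <= nL)%N then rc (filter pL xs) k
      else if (n - nR < k)%N then rc (filter pR xs) (k - (n - nR))%N
      else rc (filter pM xs) (k - nLU)%N in
    (rc S iu + rc S iv + c + step4)%N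
  | _, _ => 0%N
  end.

End Select.

Definition prob_sample {R : realType} (n s : nat) (E : {set 'I_n} -> bool) : R :=
  (#|[set I : {set 'I_n} | (#|I| == s) && E I]|)%:R / ('C(n, s))%:R.

Definition expect_sample {R : realType} (n s : nat) (F : {set 'I_n} -> nat) : R :=
  (\sum_(I : {set 'I_n} | #|I| == s) (F I)%:R) / ('C(n, s))%:R.

(* Main.v *)
Require Import Defs.
From HB Require Import structures.
From mathcomp Require Import all_boot all_order all_algebra.
From mathcomp Require Import mathcomp_extra boolp classical_sets functions reals exp.
From mathcomp Require Import topology normedtype sequences derive realfun.
From mathcomp Require Import seq fintype finset ring lra zify.
Import Order.TTheory GRing.Theory Num.Theory.
Import numFieldNormedType.Exports.
Set Implicit Arguments.
Unset Strict Implicit.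
Unset Printing Implicit Defensive.
Local Open Scope ring_scope.

(** The number of sampled positions falling in a fixed set [A] is hypergeometric, so by
    Hoeffding's inequality it falls short of its mean [#|A| s / n] by [g] with probability
    at most [exp (- 2 g^2 / s) = n^(-2 beta)]. Taking for [A] the smallest or the largest
    positions of the input, this bounds the probability that the rank of [u] or of [v] is
    on the wrong side of [k], or more than [2 w] away from [k], where [w = g n / s]: four
    bad events. Off these events at most [min(k, n-k) + 2 w]
    elements need a second comparison and at most [4 w] elements are left for the final
    call, while [w <= sqrt (beta / alpha) f(n)] because [f(n)^3 = n^2 ln n]. For the
    expectation, two of the bad events cost at most [n] further comparisons in the
    partition, and all four at most [gammaP n] in the final call. *)

(** * Hoeffding's inequality for hypergeometric laws *)

Lemma ge0_derive_ge0 (R : realType) (f df : R -> R) (b : R) :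
  (forall x : R, is_derive x (1 : R) f (df x)) -> (forall x, 0 <= x -> 0 <= df x) ->
  f 0 = 0 -> 0 <= b -> 0 <= f b.
Proof.
move=> fdf df0 f0; rewrite le_eqVlt => /predU1P[<-|b0]; first by rewrite f0.
have [c|c] := @MVT R f df 0 b b0 (fun x _ => fdf x).
  apply: continuous_subspaceT => x.
  by apply: differentiable_continuous; apply/derivable1_diffP; apply: ex_derive.
rewrite in_itv/= f0 !subr0 => /andP[/ltW c0 _] ->.
by rewrite mulr_ge0 ?df0// ltW.
Qed.

(** The logarithm of the left side vanishes at [l = 0], has slope [p] there, and has second
    derivative at most [1/4]. Two applications of [ge0_derive_ge0], first to the slope and then to
    the function, give [p l + l^2 / 8]. *)
Lemma hoeffding_bernoulli (R : realType) (p l : R) : 0 <= p -> p <= 1 -> 0 <= l ->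
  1 - p + p * expR l <= expR (p * l + l ^+ 2 / 8).
Proof.
move=> p0 p1 l0.
pose D (x : R) : R := 1 - p + p * expR x.
have D0 x : 0 < D x.
  have e0 := expR_gt0 x; rewrite /D.
  have [->|pn] := eqVneq p 0; first by lra.
  by have : 0 < p * expR x; [rewrite mulr_gt0// lt_neqAle eq_sym pn | lra].
have dD (x : R) : is_derive x (1 : R) D (p * expR x).
  rewrite (_ : D = cst (1 - p) + p \*: expR); last by apply/funext.
  by apply: is_derive_eq; rewrite add0r.
(* [q] is the mean of the exponentially tilted Bernoulli law, hence
   [q' = q (1 - q) <= 1/4]. *)
pose q (x : R) : R := p * expR x * (D x)^-1.
have dq (x : R) : is_derive x (1 : R) q (q x * (1 - q x)).
  have dV := is_deriveV (lt0r_neq0 (D0 x)) (dD x).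
  rewrite (_ : q = (p \*: expR) * (fun y => (D y)^-1)); last by apply/funext.
  apply: is_derive_eq; rewrite !fctE /= /GRing.scale /=.
  by have := lt0r_neq0 (D0 x); set E := D x => E0; field.
have q1 : q 0 = p by rewrite /q /D expR0 !mulr1 subrK divr1.
have qle x : 0 <= x -> 0 <= p + x / 4 - q x.
  apply: (@ge0_derive_ge0 R (fun x => p + x / 4 - q x)
    (fun x => 4^-1 - q x * (1 - q x))) => [y|y _|].
  - rewrite (_ : (fun x => _) = cst p + 4^-1 \*: id - q); last first.
      by apply/funext => z; rewrite !fctE /= mulrC.
    by apply: is_derive_eq; rewrite add0r /GRing.scale /= mulr1.
  - by have := sqr_ge0 (q y - 2^-1); nra.
  - by rewrite q1; lra.
rewrite -/(D l) -[leLHS]lnK ?posrE// ler_expR -subr_ge0.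
apply: (@ge0_derive_ge0 R (fun x => p * x + x ^+ 2 / 8 - ln (D x))
  (fun x => p + x / 4 - q x)) l0 => // [y|].
- have dl : is_derive y (1 : R) (@ln R \o D) (q y).
    have Dy := is_derive1_ln (D0 y).
    by apply: (is_derive_eq (is_derive1_comp Dy (dD y))); rewrite /q mulrC.
  rewrite (_ : (fun x => _) = p \*: id + 8^-1 \*: (id ^+ 2) - (@ln R \o D)); last first.
    by apply/funext => z; rewrite !fctE /= [z ^+ 2 / 8]mulrC.
  apply: is_derive_eq; rewrite /GRing.scale /=.
  by rewrite !mulr1; field.
- by rewrite /D expR0 mulr1 subrK ln1 expr0n/=; lra.
Qed.

(** Factor by factor, [(m - i) / (n - i) <= m / n]. *)
Lemma ffact_ratio m n j : (m <= n)%N -> (m ^_ j * n ^ j <= n ^_ j * m ^ j)%N.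
Proof.
move=> mn; elim: j => [|j IHj]; first by rewrite !expn0 !ffactn0.
rewrite !ffactnSr !expnSr mulnACA [leqRHS]mulnACA; apply: leq_mul => //.
nia.
Qed.

Lemma bin_ratio m n j : (m <= n)%N -> ('C(m, j) * n ^ j <= 'C(n, j) * m ^ j)%N.
Proof.
move=> mn; rewrite -(leq_pmul2r (fact_gt0 j)).
by rewrite mulnAC [leqRHS]mulnAC !bin_ffact; apply: ffact_ratio.
Qed.

(** Both sides count nested pairs of subsets of sizes [j] and [s]; the proof clears factorials
    instead. *)
Lemma bin_subset n s j : (j <= s)%N -> (s <= n)%N ->
  ('C(n, s) * 'C(s, j) = 'C(n, j) * 'C(n - j, s - j))%N.
Proof.
move=> js sn; have jn := leq_trans js sn.
have P : (0 < j`! * (s - j)`! * (n - s)`!)%N by rewrite !muln_gt0 !fact_gt0.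
apply/eqP; rewrite -(eqn_pmul2r P); apply/eqP.
have E1 := bin_fact js; have E2 := bin_fact sn; have E3 := bin_fact jn.
have E4 : ('C(n - j, s - j) * ((s - j)`! * (n - s)`!) = (n - j)`!)%N.
  by rewrite -(@bin_fact (n - j) (s - j)) ?leq_sub2r// subnBA// subnK.
transitivity n`!.
  by rewrite -E2 -E1; ring.
by rewrite -E3 -E4; ring.
Qed.

(** Removing [J] is a bijection onto the subsets of its complement with [s - #|J|] elements. *)
Lemma card_supersets (T : finType) (J : {set T}) s : (#|J| <= s)%N ->
  #|[set I : {set T} | (#|I| == s) && (J \subset I)]| = 'C(#|T| - #|J|, s - #|J|).
Proof.
move=> Js; rewrite -(cardsC J) addKn -cards_draws.
rewrite -(card_in_imset (f := fun I => I :\: J)); last first.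
  move=> I1 I2; rewrite !inE => /andP[_ J1] /andP[_ J2] E.
  by rewrite -(setID I1 J) -(setID I2 J) E (setIidPr J1) (setIidPr J2).
apply: eq_card => K; apply/imsetP/idP => [[I]|].
  rewrite !inE => /andP[/eqP <- JI] ->.
  by rewrite cardsD (setIidPr JI) eqxx andbT -setCS setCK setDE setCI setCK subsetUr.
rewrite inE => /andP[KJ /eqP cK].
have JK : [disjoint K & J] by rewrite disjoints_subset.
exists (K :|: J); last by rewrite setDUl setDv setU0; apply/esym/setDidPl.
by rewrite !inE subsetUr andbT cardsU (disjoint_setI0 JK) cards0 subn0 cK subnK.
Qed.

(** Double counting of the pairs [J \subset A :&: I] with [#|J| = j]. Divided by the number of
    draws, this is a factorial moment of the hypergeometric law. *)
Lemma sum_bin_draws (T : finType) (A : {set T}) s j : (j <= s)%N ->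
  (\sum_(I : {set T} | #|I| == s) 'C(#|A :&: I|, j) =
   'C(#|A|, j) * 'C(#|T| - j, s - j))%N.
Proof.
move=> js.
transitivity (\sum_(I : {set T} | #|I| == s)
   \sum_(J in [set J : {set T} | J \subset A & #|J| == j]) (J \subset I))%N.
  apply: eq_bigr => I _; rewrite -cards_draws -sum1_card.
  rewrite [RHS](bigID (fun J : {set T} => J \subset I))/=.
  rewrite [X in (_ + X)%N]big1 ?addn0; last by move=> J /andP[_ /negbTE ->].
  rewrite [RHS](eq_bigr (fun=> 1%N)) => [|J /andP[_ ->]//].
  apply: eq_bigl => J; rewrite !inE subsetI.
  by rewrite andbAC.
rewrite exchange_big/= -cards_draws -sum_nat_const; apply: eq_bigr => J.
rewrite inE => /andP[_ /eqP cJ].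
rewrite -{1 2}cJ -card_supersets ?cJ// -sum1_card.
rewrite [RHS]big_mkcond [LHS]big_mkcond; apply: eq_bigr => I _.
by rewrite inE; case: (_ == _); case: (_ \subset _).
Qed.

(* The hypergeometric law is compared with the binomial one through its factorial
   moments: [E C(H, j) = C(s, j) C(m, j) / C(n, j) <= C(s, j) (m / n)^j]. *)
Lemma sum_exp_draws (R : realFieldType) (T : finType) (A : {set T}) s (x : R) :
  (0 < #|T|)%N -> (s <= #|T|)%N -> 0 <= x ->
  \sum_(I : {set T} | #|I| == s) (1 + x) ^+ #|A :&: I| <=
  'C(#|T|, s)%:R * (1 + #|A|%:R / #|T|%:R * x) ^+ s.
Proof.
move=> T0 sT x0.
have -> : \sum_(I : {set T} | #|I| == s) (1 + x) ^+ #|A :&: I| =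
    \sum_(j < s.+1) ('C(#|A|, j) * 'C(#|T| - j, s - j))%:R * x ^+ j.
  transitivity (\sum_(I : {set T} | #|I| == s)
      \sum_(j < s.+1) ('C(#|A :&: I|, j)%:R * x ^+ j)).
    apply: eq_bigr => I /eqP cI.
    have hs : (#|A :&: I| <= s)%N by rewrite -cI subset_leq_card// subsetIr.
    (* The binomial expansion is padded to a range independent of [I], so that the two sums can be
       exchanged; the added terms have a zero binomial coefficient. *)
    rewrite exprDn (big_ord_widen_cond s.+1 predT
      (fun j => 1 ^+ (#|A :&: I| - j) * x ^+ j *+ 'C(#|A :&: I|, j)))//=.
    rewrite big_mkcond/=; apply: eq_bigr => j _; rewrite expr1n mul1r ltnS.
    by case: leqP => h; rewrite ?mulr_natl// bin_small// mul0r.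
  rewrite exchange_big/=; apply: eq_bigr => j _.
  by rewrite -mulr_suml -natr_sum sum_bin_draws// -ltnS.
rewrite exprDn mulr_sumr; apply: ler_sum => -[j /= js] _; rewrite ltnS in js.
rewrite expr1n mul1r exprMn -[X in _ <= _ * X]mulr_natr !mulrA [leRHS]mulrAC ler_wpM2r ?exprn_ge0//.
rewrite mulrAC -natrM bin_subset// expr_div_n mulrA.
rewrite ler_pdivlMr ?exprn_gt0 ?ltr0n// -!natrX -!natrM ler_nat.
rewrite mulnAC [leqRHS]mulnAC leq_mul2r; apply/orP; right.
exact: bin_ratio (max_card _).
Qed.

Lemma hypergeometric_upper_tail (R : realType) (T : finType) (A : {set T}) s (g : R) :
  (0 < s <= #|T|)%N -> 0 <= g ->
  #|[set I : {set T} | (#|I| == s) &&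
      (#|A|%:R * s%:R / #|T|%:R + g <= #|A :&: I|%:R)]|%:R <=
  'C(#|T|, s)%:R * expR (- (2 * g ^+ 2 / s%:R)).
Proof.
move=> /andP[s0 sT] g0; have T0 := leq_trans s0 sT.
have s0R : 0 < s%:R :> R by rewrite ltr0n.
have T0R : 0 < #|T|%:R :> R by rewrite ltr0n.
(* This [l] minimises the Chernoff exponent [s l^2 / 8 - l g], with minimum [- 2 g^2 / s]. *)
pose l : R := 4 * g / s%:R; pose p : R := #|A|%:R / #|T|%:R.
have l0 : 0 <= l by rewrite divr_ge0 ?mulr_ge0// ltW.
have p0 : 0 <= p by rewrite divr_ge0.
have p1 : p <= 1 by rewrite ler_pdivrMr// mul1r ler_nat max_card.
have e1 : 1 + (expR l - 1) = expR l by rewrite addrC subrK.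
set E := [set I : {set T} | _].
have markov : #|E|%:R * expR (l * (p * s%:R + g)) <=
    \sum_(I : {set T} | #|I| == s) (1 + (expR l - 1)) ^+ #|A :&: I|.
  rewrite -sum1_card natr_sum mulr_suml.
  rewrite [leRHS](bigID (mem E))/= ler_wpDr//.
    by rewrite sumr_ge0// => I _; rewrite exprn_ge0// e1 expR_ge0.
  rewrite [leLHS](eq_bigl (fun I : {set T} => (#|I| == s) && (I \in E))); last first.
    by move=> I; rewrite !inE; case: (_ == _).
  apply: ler_sum => I /andP[_]; rewrite inE => /andP[_ HI].
  rewrite mul1r e1 -expRM_natl ler_expR [leRHS]mulrC ler_wpM2l//.
  by rewrite /p mulrAC.
have M := le_trans markov (sum_exp_draws A T0 sT _).
rewrite -/p in M.
have {}M : #|E|%:R * expR (l * (p * s%:R + g)) <=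
    'C(#|T|, s)%:R * expR (s%:R * (p * l + l ^+ 2 / 8)).
  apply: le_trans (M _) _; first by rewrite subr_ge0 -expR0 ler_expR.
  rewrite ler_wpM2l// expRM_natl lerXn2r ?nnegrE ?expR_ge0//.
    by rewrite addr_ge0// mulr_ge0// subr_ge0 -expR0 ler_expR.
  by rewrite (le_trans _ (hoeffding_bernoulli p0 p1 l0))//; lra.
rewrite -(ler_pM2r (expR_gt0 (l * (p * s%:R + g)))) -[leRHS]mulrA -expRD.
apply: le_trans M _; rewrite ler_wpM2l// ler_expR le_eqVlt; apply/orP; left.
by apply/eqP; rewrite /l; field; rewrite gt_eqF.
Qed.

(** A deficit of sampled elements in [A] is an equal excess in [~: A]. *)
Lemma hypergeometric_lower_tail (R : realType) (T : finType) (A : {set T}) s (g : R) :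
  (0 < s <= #|T|)%N -> 0 <= g ->
  #|[set I : {set T} | (#|I| == s) &&
      (#|A :&: I|%:R <= #|A|%:R * s%:R / #|T|%:R - g)]|%:R <=
  'C(#|T|, s)%:R * expR (- (2 * g ^+ 2 / s%:R)).
Proof.
move=> sT g0; apply: le_trans (hypergeometric_upper_tail (~: A) sT g0).
have T0R : 0 < #|T|%:R :> R by rewrite ltr0n; case/andP: sT; apply: leq_trans.
rewrite ler_nat subset_leq_card//; apply/subsetP => I; rewrite !inE.
move=> /andP[cI]; rewrite cI/=; move: cI => /eqP cI.
have -> : #|~: A|%:R = #|T|%:R - #|A|%:R :> R by rewrite -(cardsC A) natrD addrC addKr.
have -> : #|~: A :&: I|%:R = s%:R - #|A :&: I|%:R :> R.
  by rewrite -cI -(cardsID A I) natrD setDE ![I :&: _]setIC addrC addKr.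
have -> : (#|T|%:R - #|A|%:R) * s%:R / #|T|%:R = s%:R - #|A|%:R * s%:R / #|T|%:R :> R.
  by field; rewrite gt_eqF.
lra.
Qed.

(** * Ranks of the pivots *)

(** Take the first [m] entries of a sorted enumeration; ties are broken by the sort. If some [a] of
    them were outside [D], closure would put all of [D] strictly before [a], leaving fewer than [m]
    elements. The point is that [A] does not depend on [D]. *)
Lemma initial_segment (T : finType) (le : rel T) m :
  total le -> transitive le -> (m <= #|T|)%N ->
  exists2 A : {set T}, #|A| = m &
    forall D : {set T}, (forall i j, le i j -> j \in D -> i \in D) ->
      (m <= #|D|)%N -> A \subset D.
Proof.
move=> le_total le_trans mT; pose e := sort le (enum T).
have ue : uniq e by rewrite sort_uniq enum_uniq.
have se : size e = #|T| by rewrite size_sort cardE.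
have me i : i \in e by rewrite mem_sort mem_enum.
exists [set i in take m e].
  by rewrite cardsE (card_uniqP _) ?take_uniq// size_take_min se (minn_idPl mT).
move=> D closedD mD; apply/subsetP => a; rewrite inE => ae; apply/contraT => aD.
have am : (index a e < m)%N by rewrite in_take_leq ?se in ae.
suff /subset_leq_card : D \subset [set i in take (index a e) e].
  rewrite cardsE (card_uniqP _) ?take_uniq// size_take_min => /(leq_trans mD).
  by rewrite leq_min leqNgt am.
apply/subsetP => b bD; rewrite inE in_take_leq ?index_size//.
rewrite ltnNge; apply: contra aD => ab; apply: closedD bD.
have ltS x : (index x e < size e)%N by rewrite index_mem.
rewrite -(nth_index a (me a)) -(nth_index a (me b)).
have le_refl : reflexive le by move=> x; have := le_total x x; rewrite orbb.
by apply: (sorted_leq_nth le_trans le_refl a (sort_sorted le_total _)); rewrite ?inE.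
Qed.

(** Hoeffding's inequality needs a fixed set, but [D I] varies with the sample. When [D I] has at
    least [K] elements it contains the fixed initial segment [A] of size the least integer [m >= K],
    so [A] too meets the sample in at most [t] points, which is [g] below the mean. *)
Lemma down_set_tail (R : realType) (T : finType) (le : rel T) s (g K t : R)
    (D : {set T} -> {set T}) :
  total le -> transitive le -> (0 < s <= #|T|)%N -> 0 <= g ->
  (forall I i j, le i j -> j \in D I -> i \in D I) ->
  (forall I : {set T}, #|I| = s -> #|D I :&: I|%:R <= t) ->
  t <= K * s%:R / #|T|%:R - g ->
  #|[set I : {set T} | (#|I| == s) && (K <= #|D I|%:R)]|%:R <=
  'C(#|T|, s)%:R * expR (- (2 * g ^+ 2 / s%:R)).
Proof.
move=> leT_total leT_tr sT g0 closedD Dt tK; set E := [set I | _].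
(* A member of the event is what guarantees [m <= #|T|], so that the segment exists. *)
have [->|[I0]] := set_0Vmem E; first by rewrite cards0 mulr_ge0 ?expR_ge0.
rewrite inE => /andP[_ KI0].
have exK : exists m, K <= m%:R by exists #|D I0|.
pose m := ex_minn exK.
have [Km minm] : K <= m%:R /\ forall m', K <= m'%:R -> (m <= m')%N.
  by rewrite /m; case: ex_minnP.
have mT : (m <= #|T|)%N := leq_trans (minm _ KI0) (max_card _).
have [A cA AD] := initial_segment leT_total leT_tr mT.
apply: le_trans (hypergeometric_lower_tail A sT g0).
rewrite ler_nat subset_leq_card//; apply/subsetP => I; rewrite !inE.
move=> /andP[sI KI]; rewrite sI/=.
apply: (@le_trans _ _ t); last first.
  apply: (le_trans tK); rewrite lerD2r ler_wpM2r ?invr_ge0// ler_wpM2r//.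
  by rewrite cA.
apply: le_trans (Dt I (eqP sI)).
by rewrite ler_nat subset_leq_card// setSI// AD ?minm//; apply: closedD.
Qed.

Lemma count_lt_nth_sorted (d : Order.disp_t) (T : orderType d) (x0 : T) (l : seq T) i :
  (i < size l)%N ->
  (count (fun x => (x < nth x0 (sort <=%O l) i)%O) l <= i)%N.
Proof.
move=> il; rewrite -(count_sort <=%O) -{2}(cat_take_drop i (sort <=%O l)) count_cat.
rewrite [X in (_ + X)%N](_ : _ = 0%N) ?addn0.
  by rewrite (leq_trans (count_size _ _))// size_take_min geq_minl.
apply/eqP; rewrite -leqn0 leqNgt -has_count; apply/hasPn => x /(nthP x0)[j].
rewrite size_drop size_sort nth_drop => jl <-; rewrite -leNgt.
apply: (sorted_leq_nth le_trans (@lexx _ _) x0 (sort_le_sorted l));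
  by rewrite ?inE ?size_sort ?leq_addr// -ltn_subRL.
Qed.

Lemma count_gt_nth_sorted (d : Order.disp_t) (T : orderType d) (x0 : T) (l : seq T) i :
  (i < size l)%N ->
  (count (fun x => (nth x0 (sort <=%O l) i < x)%O) l <= size l - i.+1)%N.
Proof.
move=> il; rewrite -(count_sort <=%O) -{2}(cat_take_drop i.+1 (sort <=%O l)) count_cat.
rewrite [X in (X + _)%N](_ : _ = 0%N) ?add0n.
  by rewrite (leq_trans (count_size _ _))// size_drop size_sort.
apply/eqP; rewrite -leqn0 leqNgt -has_count; apply/hasPn => x /(nthP x0)[j].
rewrite size_take_min leq_min ltnS => /andP[ji jl]; rewrite nth_take ?ltnS// => <-.
rewrite -leNgt.
rewrite size_sort in jl.
by apply: (sorted_leq_nth le_trans (@lexx _ _) x0 (sort_le_sorted l));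
  rewrite ?inE ?size_sort.
Qed.

Definition sample {d : Order.disp_t} {T : orderType d} n (X : n.-tuple T)
  (I : {set 'I_n}) : seq T := [seq tnth X j | j <- enum I].

(** A total form of [order_stat], with default [x0], so that events about pivots make sense for sets
    [I] of any size. *)
Definition pivot {d : Order.disp_t} {T : orderType d} (x0 : T) n (X : n.-tuple T)
  (i : nat) (I : {set 'I_n}) : T := nth x0 (sort <=%O (sample X I)) i.-1.

Lemma size_sample (d : Order.disp_t) (T : orderType d) n (X : n.-tuple T)
  (I : {set 'I_n}) : size (sample X I) = #|I|.
Proof. by rewrite size_map -cardE. Qed.

Lemma order_stat_pivot (d : Order.disp_t) (T : orderType d) (x0 : T) n (X : n.-tuple T)
    i (I : {set 'I_n}) : (0 < i <= #|I|)%N ->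
  order_stat (sample X I) i = Some (pivot x0 X i I).
Proof.
move=> /andP[i0]; rewrite -(size_sample X) => iI; rewrite /order_stat /pivot.
case: (sample X I) iI => [|y l] iI; first by case: i i0 iI.
by congr Some; apply: set_nth_default; rewrite size_sort; case: i i0 iI.
Qed.

Lemma count_sample (d : Order.disp_t) (T : orderType d) n (X : n.-tuple T)
    (P : pred T) (I : {set 'I_n}) :
  count P (sample X I) = #|[set j | P (tnth X j)] :&: I|.
Proof.
rewrite count_map -size_filter cardE /enum_mem -filter_predI; congr size.
by apply: eq_filter => j; rewrite !inE.
Qed.

Lemma count_tuple (d : Order.disp_t) (T : orderType d) n (X : n.-tuple T) (P : pred T) :
  count P X = #|[set j | P (tnth X j)]|.
Proof.
rewrite -[in RHS](setIT [set j | _]) -count_sample /sample enum_setT -enumT.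
by rewrite map_tnth_enum.
Qed.

(** At most [i - 1] sampled elements lie strictly below the sample element of rank [i], whatever the
    repetitions; this is the [t] of [down_set_tail], for positions ordered by value. *)
Lemma pivot_lt_tail (R : realType) (d : Order.disp_t) (T : orderType d) (x0 : T) n
    (X : n.-tuple T) s i (g K : R) :
  (0 < i <= s)%N -> (s <= n)%N -> 0 <= g ->
  i%:R - 1 <= K * s%:R / n%:R - g ->
  #|[set I : {set 'I_n} | (#|I| == s) &&
      (K <= (count (fun x => x < pivot x0 X i I)%O X)%:R)]|%:R <=
  'C(n, s)%:R * expR (- (2 * g ^+ 2 / s%:R)).
Proof.
move=> /andP[i0 is_] sn g0 iK; have s0 := leq_trans i0 is_.
pose D (I : {set 'I_n}) := [set j | (tnth X j < pivot x0 X i I)%O].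
have := @down_set_tail R 'I_n (fun a b => (tnth X a <= tnth X b)%O) s g K (i%:R - 1) D.
rewrite card_ord => H; under eq_finset do rewrite count_tuple; apply: H => //.
- by move=> a b; exact: le_total.
- by move=> a b c; exact: le_trans.
- by rewrite s0.
- by move=> I a b ab; rewrite !inE; apply: le_lt_trans.
- move=> I cI; rewrite /D -(count_sample X (fun x => (x < pivot x0 X i I)%O)).
  rewrite -(natrB _ i0) ler_nat subn1 count_lt_nth_sorted// size_sample cI.
  by rewrite prednK.
Qed.

(** The same with the order reversed: at most [s - i] sampled elements lie strictly above. *)
Lemma pivot_gt_tail (R : realType) (d : Order.disp_t) (T : orderType d) (x0 : T) n
    (X : n.-tuple T) s i (g K : R) :
  (0 < i <= s)%N -> (s <= n)%N -> 0 <= g ->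
  s%:R - i%:R <= K * s%:R / n%:R - g ->
  #|[set I : {set 'I_n} | (#|I| == s) &&
      (K <= (count (fun x => pivot x0 X i I < x)%O X)%:R)]|%:R <=
  'C(n, s)%:R * expR (- (2 * g ^+ 2 / s%:R)).
Proof.
move=> /andP[i0 is_] sn g0 iK; have s0 := leq_trans i0 is_.
pose D (I : {set 'I_n}) := [set j | (pivot x0 X i I < tnth X j)%O].
have := @down_set_tail R 'I_n (fun a b => (tnth X b <= tnth X a)%O) s g K (s%:R - i%:R) D.
rewrite card_ord => H; under eq_finset do rewrite count_tuple; apply: H => //.
- by move=> a b; exact: le_total.
- by move=> a b c ab bc; exact: le_trans bc ab.
- by rewrite s0.
- by move=> I a b ab; rewrite !inE => /lt_le_trans; apply.
- move=> I cI; rewrite /D -(count_sample X (fun x => (pivot x0 X i I < x)%O)).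
  rewrite -(natrB _ is_) ler_nat.
  have ii : i.-1.+1 = i by rewrite prednK.
  rewrite -{2}ii -{1}cI -(size_sample X) count_gt_nth_sorted// size_sample cI.
  by rewrite ii.
Qed.

(** * Size of the residual problem *)

(** The final step of [select_count] with the pivots as variables, kept in the same form so that it
    can be folded there. *)
Definition residual_count {d : Order.disp_t} {T : orderType d}
    (rc : seq T -> nat -> nat) (xs : seq T) n k (u v : T) : nat :=
  let pL := (fun x => x < u)%O in
  let pU := (fun x => x == u) in
  let pM := (fun x => (u < x) && (x < v))%O in
  let pR := (fun x => v < x)%O in
  let nL := count pL xs in
  let nLU := count (fun x => pL x || pU x) xs in
  let nLUM := count (fun x => [|| pL x, pU x | pM x]) xs in
  let nR := count pR xs in
  if ((nL < k <= nLU) || (nLUM < k <= n - nR))%N then 0%N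
  else if (k <= nL)%N then rc (filter pL xs) k
  else if (n - nR < k)%N then rc (filter pR xs) (k - (n - nR))%N
  else rc (filter pM xs) (k - nLU)%N.

Lemma residual_count_le (R : realType) (d : Order.disp_t) (T : orderType d)
    (rc : seq T -> nat -> nat) (gammaP : R) (xs : seq T) k (u v : T) :
  (forall (l : seq T) (i : nat), (0 < i <= size l)%N ->
     (rc l i)%:R <= gammaP * (size l)%:R) ->
  (0 < k <= size xs)%N ->
  exists2 N : nat, (residual_count rc xs (size xs) k u v)%:R <= gammaP * N%:R &
   [\/ N = 0%N,
       (k <= count (fun x => x < u)%O xs)%N /\ N = count (fun x => x < u)%O xs,
       (size xs - k < count (fun x => v < x)%O xs)%N /\ N = count (fun x => v < x)%O xs
     | N = count (fun x => (u < x) && (x < v))%O xs].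
Proof.
move=> rcP /andP[k0 kn]; rewrite /residual_count.
set nL := count (fun x => x < u)%O xs; set nR := count (fun x => v < x)%O xs.
set nLU := count (fun x => _ || _) xs; set nLUM := count (fun x => [|| _, _ | _]) xs.
case: ifPn => [_|]; first by exists 0%N; rewrite ?mulr0//; constructor.
rewrite negb_or => /andP[h1 h2].
have nRn : (nR <= size xs)%N by rewrite count_size.
case: ifPn => [kL|]; first exists nL.
- by rewrite /nL -size_filter; apply: rcP; rewrite size_filter k0.
- by apply: Or42.
rewrite -ltnNge => kL; case: ifPn => [kR|]; first exists nR.
- by rewrite /nR -size_filter; apply: rcP; rewrite size_filter -/nR; lia.
- by apply: Or43; split => //; lia.
rewrite -leqNgt => kR.
exists (count (fun x => (u < x) && (x < v))%O xs); last exact: Or44.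
rewrite -size_filter; apply: rcP; rewrite size_filter.
(* Since both return tests failed, [nLU < k <= nLUM]; disjointness of the classes then makes
   [k - nLU] a legal rank in the middle part. *)
have : nLUM = (nLU + count (fun x => (u < x) && (x < v))%O xs)%N.
  rewrite /nLUM /nLU -count_predUI [X in _ = (_ + X)%N](_ : _ = 0%N) ?addn0.
    by apply: eq_count => x /=; rewrite orbA.
  rewrite -[RHS](count_pred0 xs); apply: eq_count => x /=.
  by case: (ltgtP x u).
move: h1 h2; rewrite kL kR andbT /= -ltnNge -leqNgt => h1 h2 E.
by rewrite subn_gt0 h1 leq_subLR -E.
Qed.

(** For [u < v] every element is above [u] or below [v], so inclusion-exclusion gives equality with
    the sum. For [u = v] the middle is empty, which the [maxn] accounts for. *)
Lemma count_between (d : Order.disp_t) (T : orderType d) (xs : seq T) (u v : T) :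
  (u <= v)%O ->
  (count (fun x => (u < x) && (x < v))%O xs + size xs <=
   maxn (size xs) (count (fun x => u < x)%O xs + count (fun x => x < v)%O xs))%N.
Proof.
rewrite le_eqVlt => /predU1P[->|uv].
  rewrite (@eq_count _ _ pred0) ?count_pred0 ?leq_maxl// => x /=.
  by case: (ltgtP x v).
rewrite -count_predUI addnC leq_max; apply/orP; right.
rewrite leq_add2r -[leqLHS](count_predT xs); apply: sub_count => x _ /=.
by case: (ltP u x) => //= /le_lt_trans; apply.
Qed.

(** The middle part has at most [(n - k + 2 w) + (k + 2 w) - n = 4 w] elements, where [n] is the
    size of [xs]. The left part is searched only when [k <= w], and then it has at most
    [k + 2 w <= 3 w] elements, being below [v]; the right part is symmetric. *)
Lemma residual_count_le_gap (R : realType) (d : Order.disp_t) (T : orderType d)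
    (rc : seq T -> nat -> nat) (gammaP : R) (xs : seq T) k (u v : T) (w : R) :
  (forall (l : seq T) (i : nat), (0 < i <= size l)%N ->
     (rc l i)%:R <= gammaP * (size l)%:R) ->
  (0 < k <= size xs)%N -> 0 <= gammaP -> 0 <= w -> (u <= v)%O ->
  (k%:R <= w \/ (count (fun x => x < u)%O xs < k)%N) ->
  ((size xs - k)%:R <= w \/ (count (fun x => v < x)%O xs <= size xs - k)%N) ->
  (count (fun x => u < x)%O xs)%:R <= (size xs - k)%:R + 2 * w ->
  (count (fun x => x < v)%O xs)%:R <= k%:R + 2 * w ->
  (residual_count rc xs (size xs) k u v)%:R <= gammaP * (4 * w).
Proof.
move=> rcP kn g0 w0 uv hL hR hu hv.
have [N le_N hN] := residual_count_le u v rcP kn.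
apply: (le_trans le_N); rewrite ler_wpM2l//; case: hN.
- by move=> ->; lra.
- move=> [kL ->]; case: hL => [kw|]; last by lia.
  have : (count (fun x => x < u)%O xs)%:R <= (count (fun x => x < v)%O xs)%:R :> R.
    by rewrite ler_nat; apply: sub_count => x /= /lt_le_trans; apply.
  by lra.
- move=> [kR ->]; case: hR => [kw|]; last by lia.
  have : (count (fun x => v < x)%O xs)%:R <= (count (fun x => u < x)%O xs)%:R :> R.
    by rewrite ler_nat; apply: sub_count => x /=; apply: le_lt_trans.
  by lra.
- move=> ->; have := count_between xs uv; case/andP: kn => _ kn.
  rewrite leq_max => /orP[h|].
    by rewrite (_ : count _ _ = 0%N); [lra | lia].
  rewrite -(ler_nat R) !natrD; move: hu; rewrite natrB//; lra.
Qed.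

(** * Parameters of the algorithm *)

Lemma expR1_le3 (R : realType) : expR 1 <= 3 :> R.
Proof.
(* From [exp (-1/6) >= 5/6] follows [exp 1 <= (6/5)^6 < 3]. *)
have h : expR (6^-1 : R) <= 6 / 5.
  have e := expR_ge1Dx (- 6^-1 : R).
  rewrite -[leLHS]invrK -expRN -[leRHS]invrK lef_pV2 ?posrE ?expR_gt0//; lra.
have -> : 1 = 6%:R * 6^-1 :> R by field.
rewrite expRM_natl (le_trans (lerXn2r 6 _ _ h)) ?nnegrE ?expR_ge0//; lra.
Qed.

Lemma ln_ge1 (R : realType) n : (2 < n)%N -> 1 <= ln n%:R :> R.
Proof.
move=> n3; have n3R : 3 <= n%:R :> R by rewrite (ler_nat R 3 n).
rewrite -[leLHS]expRK ler_ln ?posrE ?expR_gt0//; last by lra.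
exact: le_trans (expR1_le3 R) n3R.
Qed.

Lemma fsel_cube (R : realType) n : (2 < n)%N ->
  fsel n ^+ 3 = n%:R ^+ 2 * ln n%:R :> R.
Proof.
move=> n3; have L1 := ln_ge1 R n3.
rewrite /fsel exprMn -!powR_mulrn ?powR_ge0// -!powRrM.
rewrite (_ : 2 / 3 * 3%:R = 2%:R :> R); last by field.
by rewrite (_ : 1 / 3 * 3%:R = 1 :> R) ?powRr1 ?powR_mulrn//; [lra|field].
Qed.

Lemma powR_le_fsel (R : realType) n : (2 < n)%N -> n%:R `^ (2 / 3) <= fsel n :> R.
Proof.
move=> n3; have L1 := ln_ge1 R n3; rewrite /fsel ler_peMr ?powR_ge0//.
have := ler_powR L1 (_ : 0 <= 1 / 3); rewrite powRr0; apply; lra.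
Qed.

Lemma fsel_gt0 (R : realType) n : (2 < n)%N -> 0 < fsel n :> R.
Proof.
by move=> n3; rewrite (lt_le_trans _ (powR_le_fsel R n3))// powR_gt0// ltr0n (leq_trans _ n3).
Qed.

Lemma fsel_le (R : realType) m n : (2 < m <= n)%N -> fsel m <= fsel n :> R.
Proof.
move=> /andP[m3 mn]; have n3 := leq_trans m3 mn.
have Lm := ln_ge1 R m3; have Ln := ln_ge1 R n3.
have mnR : m%:R <= n%:R :> R by rewrite ler_nat.
have m0 : 0 < m%:R :> R by rewrite ltr0n (leq_trans _ m3).
rewrite /fsel ler_pM ?powR_ge0// ge0_ler_powR ?nnegrE//; try lra.
by rewrite ler_ln ?posrE//; lra.
Qed.

(** The strict inequality means that the minimum is the ceiling of [alpha f(n)]. It also excludes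
    [n <= 2]: for [n = 2] the sample would be empty, although [f(2) > 0]. *)
Lemma sample_size_bounds (R : realType) (alpha : R) n :
  0 < alpha -> (sample_size alpha n < n.-1)%N ->
  [/\ (2 < n)%N, (0 < sample_size alpha n < n)%N,
      alpha * fsel n <= (sample_size alpha n)%:R
    & (sample_size alpha n)%:R <= alpha * fsel n + 1].
Proof.
move=> a0; rewrite /sample_size => h.
have hn : (`|Num.ceil (alpha * fsel n)| < n.-1)%N by move: h; rewrite gtn_min ltnn orbF.
rewrite (minn_idPl (ltnW hn)) in h *.
have n3 : (2 < n)%N.
  move: n hn {h} => [|[|[|n]]]//; rewrite /= ltnS leqn0 absz_eq0 => /eqP c0.
  have : 0 < alpha * fsel 2 :> R.
    by rewrite mulr_gt0// /fsel mulr_gt0// powR_gt0// ln_gt0// (ltr_nat R 1 2).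
  by rewrite -ceil_gt0 c0.
have p0 : 0 < alpha * fsel n by rewrite mulr_gt0 ?fsel_gt0.
have c0 : 0 < Num.ceil (alpha * fsel n) by rewrite ceil_gt0.
have E : `|Num.ceil (alpha * fsel n)|%:R = (Num.ceil (alpha * fsel n))%:~R :> R.
  by rewrite natr_absz gtr0_norm.
split => //.
- by rewrite absz_gt0 gt_eqF//= (leq_trans hn)// leq_pred.
- by rewrite E ceil_ge.
- by rewrite E; have := ceilB1_lt (alpha * fsel n); rewrite intrB; lra.
Qed.

(** The last bound is conditional because for [a <= g] the index is clamped to [1], above
    [a - g]. *)
Lemma idx_u_bounds (R : realType) (alpha beta : R) n k :
  let s := sample_size alpha n in let a := k%:R * s%:R / n%:R in
  let g := gap alpha beta n in let i := idx_u alpha beta n k in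
  (0 < s)%N -> (0 < k <= n)%N ->
  [/\ (0 < i <= s)%N, a - g <= i%:R & g < a -> i%:R - 1 < a - g].
Proof.
move=> s a g i s0 /andP[k0 kn].
have n0 : 0 < n%:R :> R by rewrite ltr0n (leq_trans k0).
have g0 : 0 <= g by exact: sqrtr_ge0.
have as_ : a <= s%:R by rewrite /a ler_pdivrMr// mulrC ler_wpM2l// ler_nat.
have cs : Num.ceil (a - g) <= s%:Z by rewrite ceil_le_int; change (a - g <= s%:R); lra.
rewrite /i /idx_u -/s -/a -/g; set c := Num.ceil (a - g) in cs *.
have c1 : 1 <= Num.max c 1 by rewrite le_max lexx orbT.
have E : `|Num.max c 1|%:R = (Num.max c 1)%:~R :> R.
  by rewrite natr_absz ger0_norm// (le_trans _ c1).
split.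
- rewrite absz_gt0 gt_eqF ?(lt_le_trans _ c1)//=.
  by rewrite -lez_nat gez0_abs ?(le_trans _ c1)// ge_max cs lez_nat.
- by rewrite E (le_trans (ceil_ge _))// ler_int le_max lexx.
- move=> ga; rewrite E (max_idPl _); last by rewrite -gtz0_ge1 ceil_gt0; lra.
  by have := ceilB1_lt (a - g); rewrite -/c intrB; lra.
Qed.

Lemma idx_v_bounds (R : realType) (alpha beta : R) n k :
  let s := sample_size alpha n in let a := k%:R * s%:R / n%:R in
  let g := gap alpha beta n in let i := idx_v alpha beta n k in
  (0 < s)%N -> (0 < k <= n)%N ->
  [/\ (0 < i <= s)%N, i%:R - 1 <= a + g & a + g <= s%:R -> a + g <= i%:R].
Proof.
move=> s a g i s0 /andP[k0 kn].
have n0 : 0 < n%:R :> R by rewrite ltr0n (leq_trans k0).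
have g0 : 0 <= g by exact: sqrtr_ge0.
have a0 : 0 < a by rewrite /a divr_gt0// mulr_gt0// ltr0n.
have c0 : 0 < Num.ceil (a + g) by rewrite ceil_gt0; lra.
rewrite /i /idx_v -/s -/a -/g; set c := Num.ceil (a + g) in c0 *.
have m0 : 0 < Num.min c s by rewrite lt_min c0 ltz_nat.
have E : `|Num.min c s|%:R = (Num.min c s)%:~R :> R by rewrite natr_absz gtr0_norm.
split.
- by rewrite absz_gt0 gt_eqF//= -lez_nat gtz0_abs// ge_min lexx orbT.
- have : (Num.min c s)%:~R <= c%:~R :> R by rewrite ler_int ge_min lexx.
  by rewrite E; have := ceilB1_lt (a + g); rewrite -/c intrB; lra.
- move=> ags; rewrite E (min_idPl _) ?ceil_ge//.
  by rewrite /c ceil_le_int.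
Qed.

(** If neither index is clamped, [i_u - 1 < a - g <= a + g <= i_v]; otherwise [i_u = 1] or
    [i_v = s]. *)
Lemma idx_u_le_idx_v (R : realType) (alpha beta : R) n k :
  let s := sample_size alpha n in
  (0 < s)%N -> (0 < k <= n)%N -> (idx_u alpha beta n k <= idx_v alpha beta n k)%N.
Proof.
move=> s s0 kn.
have [/andP[u0 us] _ hu] := idx_u_bounds beta s0 kn.
have [/andP[v0 vs] _ hv] := idx_v_bounds beta s0 kn.
move: kn hu hv us vs; rewrite -/s; set a := k%:R * _ / _; set g := gap _ _ _.
move=> /andP[k0 kn] hu hv us vs.
have g0 : 0 <= g by exact: sqrtr_ge0.
have [ga|ag] := ltP g a; last first.
  suff -> : idx_u alpha beta n k = 1%N by [].
  rewrite /idx_u -/s -/a -/g (max_idPr _)//.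
  by rewrite ceil_le_int; change (a - g <= 1); lra.
have [ags|sag] := leP (a + g) s%:R.
  by rewrite -ltnS -(ltr_nat R) -natr1; have := hu ga; have := hv ags; lra.
suff -> : idx_v alpha beta n k = s by [].
rewrite /idx_v -/s -/a -/g (min_idPr _)// ltW// ceil_gt_int.
by change (s%:R < a + g).
Qed.

(** * Number of comparisons *)

Lemma pivot_le (d : Order.disp_t) (T : orderType d) (x0 : T) n (X : n.-tuple T)
    i j (I : {set 'I_n}) : (i <= j)%N -> (0 < j <= #|I|)%N ->
  (pivot x0 X i I <= pivot x0 X j I)%O.
Proof.
move=> ij /andP[j0 jI].
apply: (sorted_leq_nth le_trans (@lexx _ _) x0 (sort_le_sorted _));
  by rewrite ?inE ?size_sort ?size_sample; lia.
Qed.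

Lemma count_sample_le (d : Order.disp_t) (T : orderType d) n (X : n.-tuple T)
    (P : pred T) (I : {set 'I_n}) : (count P (sample X I) <= count P X)%N.
Proof. by rewrite count_sample count_tuple subset_leq_card// subsetIl. Qed.

(** Second comparisons are made on the side expected to hold about [min(k, n - k)] elements. If that
    side exceeds its bound by more than [2 w], the trivial bound [n] is charged to the indicator of
    this event; which of the two indicators matters depends on [k]. *)
Lemma partition_count_le (R : realType) (d : Order.disp_t) (T : orderType d) n
    (X : n.-tuple T) s k (I : {set 'I_n}) (u v : T) (w : R) :
  (s <= n)%N -> 0 <= w -> (k <= n)%N ->
  (if (u < v)%O then
     (if (k.*2 < n)%N then ((n - s) + count (fun x => x < v)%O (sample X (~: I)))%N
      else ((n - s) + count (fun x => u < x)%O (sample X (~: I))))%N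
   else (n - s)%N)%:R <=
  (n + minn k (n - k))%:R - s%:R + 2 * w +
  n%:R * (((n - k)%:R + 2 * w <= (count (fun x => u < x)%O X)%:R)%R%:R +
          (k%:R + 2 * w <= (count (fun x => x < v)%O X)%:R)%R%:R) :> R.
Proof.
move=> sn w0 kn; set b := (_ <= (count (fun x => u < x)%O X)%:R).
set e := (_ <= (count (fun x => x < v)%O X)%:R).
have bd0 : 0 <= n%:R * (b%:R + e%:R) :> R by rewrite mulr_ge0// addr_ge0.
have m0 : 0 <= (minn k (n - k))%:R :> R by [].
rewrite natrD; case: ifP => _; last by rewrite natrB//; lra.
case: ifP => kk; rewrite natrD natrB//.
- have -> : minn k (n - k) = k by lia.
  have : (count (fun x => x < v)%O (sample X (~: I)))%:R <=
         (count (fun x => x < v)%O X)%:R :> R by rewrite ler_nat count_sample_le.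
  have : (count (fun x => x < v)%O X)%:R <= n%:R :> R.
    by rewrite ler_nat -[leqRHS](size_tuple X) count_size.
  have b0 : 0 <= n%:R * b%:R :> R by rewrite mulr_ge0.
  have k0 : 0 <= k%:R :> R by [].
  rewrite mulrDr; case: (boolP e) => [_|]; first by rewrite mulr1; lra.
  by rewrite -ltNge mulr0 => /ltW; lra.
- have -> : minn k (n - k) = (n - k)%N by lia.
  have : (count (fun x => u < x)%O (sample X (~: I)))%:R <=
         (count (fun x => u < x)%O X)%:R :> R by rewrite ler_nat count_sample_le.
  have : (count (fun x => u < x)%O X)%:R <= n%:R :> R.
    by rewrite ler_nat -[leqRHS](size_tuple X) count_size.
  have b0 : 0 <= n%:R * e%:R :> R by rewrite mulr_ge0.
  have k0 : 0 <= (n - k)%:R :> R by [].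
  rewrite mulrDr; case: (boolP b) => [_|]; first by rewrite mulr1; lra.
  by rewrite -ltNge mulr0 => /ltW; lra.
Qed.

(* The first conjuncts of [u_above_rank] and [v_below_rank] say that the index of the
   pivot is not truncated to [1], respectively to [s]. *)
Definition u_above_rank {R : realType} {d : Order.disp_t} {T : orderType d}
    (alpha beta : R) (x0 : T) n (X : n.-tuple T) k (I : {set 'I_n}) : bool :=
  (gap alpha beta n < k%:R * (sample_size alpha n)%:R / n%:R) &&
  (k%:R <= (count (fun x => x < pivot x0 X (idx_u alpha beta n k) I)%O X)%:R :> R).

(** Clamping moves [idx_u] up and [idx_v] down, so the index bounds behind this event and
    [v_far_above_rank] hold for every [k]. *)
Definition u_far_below_rank {R : realType} {d : Order.disp_t} {T : orderType d}
    (alpha beta : R) (x0 : T) n (X : n.-tuple T) k (I : {set 'I_n}) : bool :=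
  (n - k)%:R + 2 * (gap alpha beta n * n%:R / (sample_size alpha n)%:R) <=
  (count (fun x => pivot x0 X (idx_u alpha beta n k) I < x)%O X)%:R.

Definition v_below_rank {R : realType} {d : Order.disp_t} {T : orderType d}
    (alpha beta : R) (x0 : T) n (X : n.-tuple T) k (I : {set 'I_n}) : bool :=
  (k%:R * (sample_size alpha n)%:R / n%:R + gap alpha beta n <=
     (sample_size alpha n)%:R) &&
  ((n - k)%:R <= (count (fun x => pivot x0 X (idx_v alpha beta n k) I < x)%O X)%:R :> R).

Definition v_far_above_rank {R : realType} {d : Order.disp_t} {T : orderType d}
    (alpha beta : R) (x0 : T) n (X : n.-tuple T) k (I : {set 'I_n}) : bool :=
  k%:R + 2 * (gap alpha beta n * n%:R / (sample_size alpha n)%:R) <=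
  (count (fun x => x < pivot x0 X (idx_v alpha beta n k) I)%O X)%:R.

(** A bound for each single sample, from which both the probability and the expectation follow.
    Finding the pivots costs [2 gammaP s], the partition contributes [- s + 2 w], and the final call
    [4 gammaP w]. *)
Lemma select_count_le (R : realType) (alpha beta gammaP : R)
    (d : Order.disp_t) (T : orderType d) (rc : seq T -> nat -> nat) (x0 : T)
    n (X : n.-tuple T) k (I : {set 'I_n}) :
  let s := sample_size alpha n in
  let w := gap alpha beta n * n%:R / s%:R in
  0 <= gammaP ->
  (forall (l : seq T) (i : nat), (0 < i <= size l)%N ->
     (rc l i)%:R <= gammaP * (size l)%:R) ->
  (0 < s <= n)%N -> (0 < k <= n)%N -> #|I| = s ->
  (select_count alpha beta rc X k I)%:R <=
  (n + minn k (n - k))%:R + (2 * gammaP - 1) * s%:R + (4 * gammaP + 2) * w +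
  n%:R * ((u_far_below_rank alpha beta x0 X k I)%:R +
          (v_far_above_rank alpha beta x0 X k I)%:R) +
  gammaP * n%:R * ((u_above_rank alpha beta x0 X k I)%:R +
          (u_far_below_rank alpha beta x0 X k I)%:R +
          (v_below_rank alpha beta x0 X k I)%:R +
          (v_far_above_rank alpha beta x0 X k I)%:R).
Proof.
move=> s w g0 rcP /andP[s0 sn] kn cI.
have [k0 kn'] := andP kn.
have [iu _ _] := idx_u_bounds beta s0 kn; have [iv _ _] := idx_v_bounds beta s0 kn.
have iuv := idx_u_le_idx_v beta s0 kn.
rewrite -/s -cI in iu iv.
have s0R : 0 < s%:R :> R by rewrite ltr0n.
have n0R : 0 < n%:R :> R by rewrite ltr0n (leq_trans k0).
have w0 : 0 <= w by rewrite divr_ge0// mulr_ge0// /gap sqrtr_ge0.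
have sX : size X = n by rewrite size_tuple.
rewrite /u_above_rank /u_far_below_rank /v_below_rank /v_far_above_rank -/s -/w.
rewrite /select_count -/s -!/(sample _ _) !(order_stat_pivot x0)//.
set u := pivot x0 X (idx_u _ _ _ _) I; set v := pivot x0 X (idx_v _ _ _ _) I.
have uv : (u <= v)%O by rewrite pivot_le.
rewrite -/(residual_count rc X n k u v) !natrD.
have r1 := rcP (sample X I) (idx_u alpha beta n k).
have r2 := rcP (sample X I) (idx_v alpha beta n k).
rewrite !size_sample cI in r1 r2; rewrite cI in iu iv.
have := partition_count_le X I u v sn w0 kn'; rewrite natrD.
move: (r1 iu) (r2 iv) => {}r1 {}r2 pc.
set a := _ && (k%:R <= _); set b := (_ <= (count (fun x => u < x)%O X)%:R) in pc *.
set c := _ && _; set e := (_ <= (count (fun x => x < v)%O X)%:R) in pc *.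
have : (residual_count rc X n k u v)%:R <=
   gammaP * (4 * w) + gammaP * n%:R * (a%:R + b%:R + c%:R + e%:R) :> R.
  have [|] := boolP [|| a, b, c | e].
    (* With a bad event, the final call is bounded by [gammaP n], and one indicator already pays for
       it. *)
    move=> h; apply: (@le_trans _ _ (gammaP * n%:R)).
      have kX : (0 < k <= size X)%N by rewrite sX.
      have [N] := residual_count_le u v rcP kX; rewrite sX => leN hN.
      apply: (le_trans leN); rewrite ler_wpM2l// ler_nat -sX.
      by case: hN => [|[_]|[_]|] ->; rewrite ?count_size.
    have gw0 : 0 <= gammaP * (4 * w) by rewrite mulr_ge0// mulr_ge0.
    apply: ler_wpDl => //; apply: ler_peMr; first by rewrite mulr_ge0.
    have p (x : bool) : 0 <= x%:R :> R by [].
    have := p a; have := p b; have := p c; have := p e.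
    by case/or4P: h => ->; rewrite /= ?mulr1n; lra.
  rewrite !negb_or => /and4P[na nb nc ne].
  rewrite (negbTE na) (negbTE nb) (negbTE nc) (negbTE ne) !addr0 mulr0 addr0.
  have := @residual_count_le_gap R d T rc gammaP X k u v w rcP.
  rewrite sX; apply => //.
  (* If the index of [u] is truncated, [k s / n <= g], that is [k <= w]. *)
  - move: na; rewrite negb_and -leNgt -ltNge ltr_nat => /orP[h|]; [left|by right].
    by rewrite /w ler_pdivlMr//; move: h; rewrite ler_pdivrMr.
  (* If the index of [v] is truncated, [s < k s / n + g], that is [n - k < w]. *)
  - move: nc; rewrite negb_and -ltNge -ltNge ltr_nat => /orP[h|/ltnW]; [left|by right].
    rewrite /w ler_pdivlMr// natrB// mulrBl; apply/ltW.
    have : s%:R * n%:R < (k%:R * s%:R / n%:R + gap alpha beta n) * n%:R by rewrite ltr_pM2r.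
    by rewrite mulrDl divfK ?gt_eqF// [n%:R * s%:R]mulrC; lra.
  - by move: nb; rewrite -ltNge => /ltW.
  - by move: ne; rewrite -ltNge => /ltW.
by rewrite -/c; lra.
Qed.

(** * Probability and expectation over the random sample *)

Lemma prob_sample_ge (R : realType) n s (E : {set 'I_n} -> bool) (Bad : {set {set 'I_n}})
    (e : R) :
  (s <= n)%N -> (forall I : {set 'I_n}, #|I| = s -> I \notin Bad -> E I) ->
  #|Bad|%:R <= 'C(n, s)%:R * e ->
  1 - e <= prob_sample s E.
Proof.
move=> sn goodE leBad; have C0 : 0 < 'C(n, s)%:R :> R by rewrite ltr0n bin_gt0.
rewrite /prob_sample ler_pdivlMr// mulrBl mul1r lerBlDr.
apply: (@le_trans _ _ (#|[set I : {set 'I_n} | (#|I| == s) && E I]|%:R + #|Bad|%:R : R)).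
  rewrite -[in X in X <= _](card_ord n) -card_draws -natrD ler_nat.
  rewrite (leq_trans _ (leq_card_setU _ _))// subset_leq_card//.
  apply/subsetP => I; rewrite !inE => /eqP sI; rewrite sI eqxx/=.
  by case: (boolP (I \in Bad)) => [|/(goodE _ sI) ->//]; rewrite orbT.
by rewrite lerD2l mulrC.
Qed.

(** Linearity of expectation. With [w1 = n] and [w2 = gammaP n], the bad events cost
    [(4 gammaP + 2) n e] in all. *)
Lemma expect_sample_le (R : realType) n s (F : {set 'I_n} -> nat) (G w1 w2 e : R)
    (a b c d : {set 'I_n} -> bool) :
  (s <= n)%N -> 0 <= w1 -> 0 <= w2 ->
  (forall I : {set 'I_n}, #|I| = s ->
    (F I)%:R <= G + w1 * ((b I)%:R + (d I)%:R) +
                w2 * ((a I)%:R + (b I)%:R + (c I)%:R + (d I)%:R)) ->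
  #|[set I : {set 'I_n} | (#|I| == s) && a I]|%:R <= 'C(n, s)%:R * e ->
  #|[set I : {set 'I_n} | (#|I| == s) && b I]|%:R <= 'C(n, s)%:R * e ->
  #|[set I : {set 'I_n} | (#|I| == s) && c I]|%:R <= 'C(n, s)%:R * e ->
  #|[set I : {set 'I_n} | (#|I| == s) && d I]|%:R <= 'C(n, s)%:R * e ->
  expect_sample s F <= G + (2 * w1 + 4 * w2) * e.
Proof.
move=> sn w10 w20 hF ha hb hc hd.
have C0 : 0 < 'C(n, s)%:R :> R by rewrite ltr0n bin_gt0.
have cardE (E : {set 'I_n} -> bool) :
    \sum_(I : {set 'I_n} | #|I| == s) (E I)%:R =
    #|[set I : {set 'I_n} | (#|I| == s) && E I]|%:R :> R.
  rewrite -sum1_card natr_sum big_mkcond [RHS]big_mkcond/=; apply: eq_bigr => I _.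
  by rewrite inE; case: (_ == _); case: (E I).
rewrite /expect_sample ler_pdivrMr//.
apply: (@le_trans _ _ (\sum_(I : {set 'I_n} | #|I| == s) (G +
  w1 * ((b I)%:R + (d I)%:R) + w2 * ((a I)%:R + (b I)%:R + (c I)%:R + (d I)%:R)))).
  by apply: ler_sum => I /eqP; apply: hF.
rewrite !big_split/= -!mulr_sumr !big_split/= !cardE.
rewrite (_ : \sum_(I : {set 'I_n} | #|I| == s) G = 'C(n, s)%:R * G); last first.
  by rewrite -[in RHS](card_ord n) -card_draws -sum1dep_card natr_sum mulr_suml;
    apply: eq_bigr => I _; rewrite mul1r.
rewrite mulrDl [G * _]mulrC -addrA lerD2l mulrDl mulrDl -!mulrA lerD//.
  by rewrite -subr_ge0; nra.
by nra.
Qed.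

Lemma rank_tails (R : realType) (alpha beta : R) (d : Order.disp_t) (T : orderType d)
    (x0 : T) n (X : n.-tuple T) k (E : {set 'I_n} -> bool) :
  let s := sample_size alpha n in
  (0 < s <= n)%N -> (0 < k <= n)%N ->
  [\/ E = u_above_rank alpha beta x0 X k, E = u_far_below_rank alpha beta x0 X k,
      E = v_below_rank alpha beta x0 X k | E = v_far_above_rank alpha beta x0 X k] ->
  #|[set I : {set 'I_n} | (#|I| == s) && E I]|%:R <=
  'C(n, s)%:R * expR (- (2 * gap alpha beta n ^+ 2 / s%:R)).
Proof.
move=> s /andP[s0 sn] kn.
have [iu ul uh] := idx_u_bounds beta s0 kn; have [iv vl vh] := idx_v_bounds beta s0 kn.
have [k0 kn'] := andP kn.
have g0 : 0 <= gap alpha beta n by rewrite /gap sqrtr_ge0.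
have s0R : s%:R != 0 :> R by rewrite gt_eqF// ltr0n.
have n0R : n%:R != 0 :> R by rewrite gt_eqF// ltr0n (leq_trans k0).
(* A surplus of [2 w] in the list is [2 g] on the scale of the sample: one [g] absorbs the offset of
   the pivot index from [k s / n], the other is the deviation in Hoeffding's inequality. For the
   events without surplus, the offset itself is the deviation. *)
have shift (K g : R) :
    (K + 2 * (g * n%:R / s%:R)) * s%:R / n%:R = K * s%:R / n%:R + 2 * g.
  by field; rewrite n0R s0R.
have complement : (n - k)%:R * s%:R / n%:R = s%:R - k%:R * s%:R / n%:R :> R.
  by rewrite natrB//; field.
have no_event (P : pred {set 'I_n}) :
    #|[set I : {set 'I_n} | (#|I| == s) && (false && P I)]|%:R <=
    'C(n, s)%:R * expR (- (2 * gap alpha beta n ^+ 2 / s%:R)) :> R.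
  rewrite (_ : [set I | _] = set0) ?cards0 ?mulr_ge0 ?expR_ge0//.
  by apply/setP => I; rewrite !inE andbF.
case=> ->; rewrite /u_above_rank /u_far_below_rank /v_below_rank /v_far_above_rank -/s.
- case: (ltP (gap _ _ _) _) => h; last exact: no_event.
  by apply: pivot_lt_tail => //; apply/ltW/uh.
- by apply: pivot_gt_tail => //; rewrite shift complement; move: ul; rewrite -/s; lra.
- case: (leP (_ + gap _ _ _) _) => h; last exact: no_event.
  by apply: pivot_gt_tail => //; rewrite complement; have := vh h; rewrite -/s; lra.
- by apply: pivot_lt_tail => //; rewrite shift; move: vl; rewrite -/s; lra.
Qed.

(** Squared, the left side is [beta n^2 ln n / s = beta f(n)^3 / s], and [s >= alpha f(n)]. *)
Lemma gap_ratio_le (R : realType) (alpha beta : R) n :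
  0 < alpha -> 0 < beta -> (sample_size alpha n < n.-1)%N ->
  gap alpha beta n * n%:R / (sample_size alpha n)%:R <= Num.sqrt (beta / alpha) * fsel n.
Proof.
move=> a0 b0 sn; have [n3 /andP[s0 _] sl _] := sample_size_bounds a0 sn.
set s := sample_size alpha n in s0 sl *.
have f0 := fsel_gt0 R n3; have L1 := ln_ge1 R n3.
have s0R : 0 < s%:R :> R by rewrite ltr0n.
have L0 : 0 <= ln n%:R :> R by lra.
rewrite -(@ler_pXn2r _ 2)// ?nnegrE; last 2 first.
- by rewrite divr_ge0// mulr_ge0// /gap sqrtr_ge0.
- by rewrite mulr_ge0 ?sqrtr_ge0// ltW.
rewrite expr_div_n (exprMn 2 (gap _ _ _)) (exprMn 2 (Num.sqrt _)) /gap !sqr_sqrtr;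
  last 2 first.
- by rewrite divr_ge0// ltW.
- by rewrite !mulr_ge0// ltW.
rewrite -/s ler_pdivrMr ?exprn_gt0//.
have -> : beta * s%:R * ln n%:R * n%:R ^+ 2 = beta * s%:R * fsel n ^+ 3.
  by rewrite fsel_cube//; ring.
have -> : beta / alpha * fsel n ^+ 2 * s%:R ^+ 2 =
    beta * s%:R * (fsel n ^+ 2 * (s%:R / alpha)) by field; rewrite gt_eqF.
have bs0 : 0 <= beta * s%:R by rewrite mulr_ge0// ltW.
rewrite ler_wpM2l// exprSr ler_wpM2l ?exprn_ge0 ?(ltW f0)//.
by rewrite ler_pdivlMr// mulrC.
Qed.

Lemma tail_exponent (R : realType) (alpha beta : R) n :
  0 <= beta -> (1 < n)%N -> (0 < sample_size alpha n)%N ->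
  expR (- (2 * gap alpha beta n ^+ 2 / (sample_size alpha n)%:R)) =
  n%:R `^ (- (2 * beta)).
Proof.
move=> b0 n1 s0.
have s0R : 0 < (sample_size alpha n)%:R :> R by rewrite ltr0n.
have n0R : 0 < n%:R :> R by rewrite ltr0n ltnW.
have L0 : 0 <= ln n%:R :> R by rewrite ln_ge0// ler1n ltnW.
rewrite /gap sqr_sqrtr ?mulr_ge0// /powR gt_eqF//; congr expR.
by field; rewrite gt_eqF.
Qed.

Theorem theorem5p1 (R : realType) (alpha beta gammaP : R)
  (d : Order.disp_t) (T : orderType d) (rc : seq T -> nat -> nat)
  (n : nat) (X : n.-tuple T) (k : nat) :
  0 < alpha -> 0 < beta -> 2 < gammaP ->
  (forall (l : seq T) (i : nat), (0 < i <= size l)%N ->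
     (rc l i)%:R <= gammaP * (size l)%:R) ->
  (1 <= k <= n)%N ->
  (sample_size alpha n < n.-1)%N ->
  let s := sample_size alpha n in
  let c := select_count alpha beta rc X k in
  let bnd := (n + minn k (n - k))%N in
  prob_sample s (fun I => (c I)%:R <= bnd%:R + gamma_hat alpha beta gammaP (fsel n) * fsel n)
    >= 1 - 4 * (n%:R) `^ (- (2 * beta))
  /\ prob_sample s (fun I => (c I)%:R <= bnd%:R + gamma_hat alpha beta gammaP (fsel 3) * fsel n)
    >= 1 - 4 * (n%:R) `^ (- (2 * beta))
  /\ (1 / 6 <= beta ->
      expect_sample s (fun I => c I)
        <= bnd%:R + (gamma_hat alpha beta gammaP (fsel n) + 4 * gammaP + 2) * fsel n).
Proof.
move=> a0 b0 g2 rcP kn sn s c bnd.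
have [n3 /andP[s0 sltn] _ sh] := sample_size_bounds a0 sn.
have s0n : (0 < s <= n)%N by rewrite s0 ltnW.
have n0 : (0 < n)%N := leq_trans (ltn0Sn 2) n3.
pose x0 := tnth X (Ordinal n0).
have f0 := fsel_gt0 R n3.
have q_eq := tail_exponent (ltW b0) (ltnW n3) s0.
set q := n%:R `^ _ in q_eq *.
pose w := gap alpha beta n * n%:R / s%:R.
have w_le : w <= Num.sqrt (beta / alpha) * fsel n := gap_ratio_le a0 b0 sn.
pose G : R := bnd%:R + (2 * gammaP - 1) * s%:R + (4 * gammaP + 2) * w.
have g0 : 0 <= gammaP by lra.
pose eva := u_above_rank alpha beta x0 X k.
pose evb := u_far_below_rank alpha beta x0 X k.
pose evc := v_below_rank alpha beta x0 X k.
pose evd := v_far_above_rank alpha beta x0 X k.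
have cG (I : {set 'I_n}) : #|I| = s -> (c I)%:R <= G +
    n%:R * ((evb I)%:R + (evd I)%:R) +
    gammaP * n%:R * ((eva I)%:R + (evb I)%:R + (evc I)%:R + (evd I)%:R).
  exact: (@select_count_le R alpha beta gammaP d T rc x0 n X k I g0 rcP s0n kn).
have tails := @rank_tails R alpha beta d T x0 n X k _ s0n kn.
rewrite q_eq -/s in tails.
have ta := tails eva (Or41 _ _ _ erefl); have tb := tails evb (Or42 _ _ _ erefl).
have tc := tails evc (Or43 _ _ _ erefl); have td := tails evd (Or44 _ _ _ erefl).
(* The rounding in [s <= alpha f(n) + 1] is absorbed through [1 <= f(n) / F]. Keeping [F] general
   treats [f(n)] and [f(3)] together. *)
have G_le F : 0 < F -> F <= fsel n ->
    G <= bnd%:R + gamma_hat alpha beta gammaP F * fsel n.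
  move=> F0 Ff; rewrite /G /gamma_hat -addrA lerD2l addrC [leRHS]mulrDl lerD//.
    by rewrite -mulrA ler_wpM2l//; lra.
  rewrite -mulrA ler_wpM2l//; first by lra.
  apply: (le_trans sh); rewrite mulrDl lerD2l mul1r [leRHS]mulrC.
  by rewrite ler_pdivlMr// mul1r.
have prob_ge F : 0 < F -> F <= fsel n -> 1 - 4 * q <=
    prob_sample s (fun I => (c I)%:R <= bnd%:R + gamma_hat alpha beta gammaP F * fsel n).
  move=> F0 Ff.
  pose ev (E : {set 'I_n} -> bool) := [set I : {set 'I_n} | (#|I| == s) && E I].
  apply: (@prob_sample_ge _ _ _ _ (ev eva :|: ev evb :|: ev evc :|: ev evd)).
  - exact: ltnW.
  - move=> I sI; rewrite !inE sI eqxx /= !negb_or => /andP[/andP[/andP[na nb] nc] nd].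
    apply: le_trans (G_le F F0 Ff); have := cG I sI.
    by rewrite (negbTE na) (negbTE nb) (negbTE nc) (negbTE nd) !addr0 !mulr0 !addr0.
  - have le4 : (#|ev eva :|: ev evb :|: ev evc :|: ev evd| <=
        #|ev eva| + #|ev evb| + #|ev evc| + #|ev evd|)%N.
      apply: (leq_trans (leq_card_setU _ _)); rewrite leq_add2r.
      apply: (leq_trans (leq_card_setU _ _)); rewrite leq_add2r.
      exact: leq_card_setU.
    move: le4; rewrite -(ler_nat R) !natrD => /le_trans; apply.
    by move: ta tb tc td; rewrite -/(ev eva) -/(ev evb) -/(ev evc) -/(ev evd); lra.
split; first exact: prob_ge.
split.
  by apply: prob_ge; [exact: fsel_gt0 | apply: fsel_le].
move=> b6.
have gn0 : 0 <= gammaP * n%:R by rewrite mulr_ge0.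
have := expect_sample_le (ltnW sltn) (ler0n _ n) gn0 cG ta tb tc td.
move=> /le_trans; apply.
(* For [beta >= 1/6] the exponent [1 - 2 beta] is at most [2/3], so the expected cost of the bad
   events is of order [f(n)]. *)
have nq : n%:R * q <= fsel n.
  apply: le_trans (powR_le_fsel R n3).
  have n1R : 1 <= n%:R :> R by rewrite ler1n.
  rewrite (_ : 2 / 3 = 1 + - (1 / 3) :> R); last by field.
  rewrite powRD; last by apply/implyP => _; rewrite gt_eqF// ltr0n.
  rewrite powRr1// ler_wpM2l// ler_powR//; lra.
have := G_le _ f0 (lexx _).
have : (4 * gammaP + 2) * (n%:R * q) <= (4 * gammaP + 2) * fsel n.
  by rewrite ler_wpM2l//; lra.
lra.
Qed.
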